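(* Let $\mathcal{K}$ be a class of measurable subsets of $\mathbb{R}^n$ closed under dilations, and let $\odot=(\odot_\lambda)_{\lambda\in[0,1]}$ be a geometric mean on $\mathcal{K}$. Let $\mu$ be a Borel measure on $\mathbb{R}^n$ with a radially decreasing density $f$, i.e. $f(tx)\ge f(x)$ for all $x\in\mathbb{R}^n$ and $t\in[0,1]$. Suppose that $\mu$ satisfies the log-Brunn-Minkowski inequality in $\mathcal{K}$ with the geometric mean $\odot$: for all $A,B\in\mathcal{K}$ and all $\lambda\in[0,1]$, $$\mu(A\odot_\lambda B)\ \ge\ \mu(A)^\lambda\mu(B)^{1-\lambda}.$$ Then $\mu$ satisfies the Brunn-Minkowski inequality in $\mathcal{K}$: for all $A,B\in\mathcal{K}$ and all $\lambda\in[0,1]$, $$\mu(\lambda A+(1-\lambda)B)^{1/n}\ \ge\ \lambda\,\mu(A)^{1/n}+(1-\lambda)\,\mu(B)^{1/n}.$$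
   Context: A class $\mathcal{K}$ of subsets of $\mathbb{R}^n$ is closed under dilations if $A\in\mathcal{K}$ implies $tA\in\mathcal{K}$ for every $t\ge0$; moreover it is assumed that $0\in A$ for every $A\in\mathcal{K}$. A geometric mean on $\mathcal{K}$ is a family $\odot=(\odot_\lambda)_{\lambda\in[0,1]}$ of maps $\mathcal{K}\times\mathcal{K}\to\mathcal{K}$, written $(A,B)\mapsto A\odot_\lambda B$, such that for all $A,B\in\mathcal{K}$ and $\lambda\in[0,1]$: the set $A\odot_\lambda B$ is measurable; $A\odot_\lambda B\subseteq\lambda A+(1-\lambda)B$; and $(sA)\odot_\lambda(tB)=s^\lambda t^{1-\lambda}(A\odot_\lambda B)$ for all $s,t>0$. Here $\lambda A+(1-\lambda)B=\{\lambda a+(1-\lambda)b:a\in A,b\in B\}$. The density is a nonnegative function with respect to Lebesgue measure. All sets whose $\mu$-measure appears, including the sums $\lambda A+(1-\lambda)B$ for $A,B\in\mathcal{K}$, are assumed measurable. Inequalities are understood in $[0,\infty]$ with $0\cdot\infty=0$. *)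

(* Defs.v *)
From HB Require Import structures.
From mathcomp Require Import all_boot all_order all_algebra.
From mathcomp Require Import all_classical all_reals all_analysis.
From mathcomp Require Import lra.
Set Implicit Arguments.
Unset Strict Implicit.
Unset Printing Implicit Defensive.
Import Order.TTheory GRing.Theory Num.Theory.
Import numFieldNormedType.Exports.
Local Open Scope classical_set_scope.
Local Open Scope ring_scope.

(* 'rV[R]_n carries its Borel sigma-algebra, so that [measurable A] means that
   A is a Borel set. *)
Section borel_rV.
Context (R : realType) (n : nat).

HB.instance Definition _ := @isMeasurable.Build
  (sigma_display (@open 'rV[R]_n)) 'rV[R]_n
  <<s @open 'rV[R]_n >>
  (@sigma_algebra0 _ setT _) (@sigma_algebraC _ _)
  (@sigma_algebra_bigcup _ setT _).

End borel_rV.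

(* The library only has Lebesgue measure on the line.  On R^n, with n written
   n.+1, it is the restriction to Borel sets of the outer measure obtained from
   countable covers by half-open boxes. *)
Section lebesgue_rV.
Context (R : realType) (n : nat).
Implicit Types (a b : 'rV[R]_n.+1) (X : set 'rV[R]_n.+1).

Definition box a b : set 'rV[R]_n.+1 :=
  [set x | forall i, a ord0 i < x ord0 i <= b ord0 i].

Definition box_volume a b : R :=
  \prod_(i < n.+1) Num.max 0 (b ord0 i - a ord0 i).

Definition lebesgue_outer X : \bar R :=
  ereal_inf [set (\sum_(k <oo) (box_volume (ab k).1 (ab k).2)%:E)%E |
    ab in [set ab : nat -> 'rV[R]_n.+1 * 'rV[R]_n.+1 |
           X `<=` \bigcup_k box (ab k).1 (ab k).2]].

Let vol (p : 'rV[R]_n.+1 * 'rV[R]_n.+1) : \bar R := (box_volume p.1 p.2)%:E.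

Lemma box_volume_ge0 a b : 0 <= box_volume a b.
Proof. by apply: prodr_ge0 => i _; rewrite le_max lexx. Qed.

Let vol_ge0 p : (0 <= vol p)%E.
Proof. by rewrite lee_fin box_volume_ge0. Qed.

Let vol00 : vol (0, 0) = 0%E.
Proof.
by rewrite /vol /box_volume big_ord_recl !mxE subrr maxxx mul0r.
Qed.

Local Open Scope ereal_scope.

Lemma lebesgue_outer_ge0 X : 0 <= lebesgue_outer X.
Proof. by apply: le_ereal_inf_tmp => _ [ab _ <-]; apply: nneseries_ge0 => k _ _; exact: vol_ge0. Qed.

Lemma lebesgue_outer0 : lebesgue_outer set0 = 0.
Proof.
apply/eqP; rewrite eq_le lebesgue_outer_ge0 andbT.
apply: ereal_inf_lbound; exists (fun=> (0, 0)%R); first by [].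
by rewrite -[RHS](@eseries0 _ (fun=> vol (0, 0)%R) 0%N xpredT).
Qed.

Lemma le_lebesgue_outer :
  {homo lebesgue_outer : A B / A `<=` B >-> A <= B}.
Proof.
move=> A B AB; apply/ereal_inf_le_tmp => _ [ab Bab <-].
by exists ab => //; exact: subset_trans Bab.
Qed.

Lemma lebesgue_outer_sigma_subadditive : sigma_subadditive lebesgue_outer.
Proof.
move=> A; have [[i ioo]|] := pselect (exists i, lebesgue_outer (A i) = +oo).
  rewrite (eseries_pinfty _ _ ioo) ?leey// => k _.
  by rewrite -ltNye (lt_le_trans _ (lebesgue_outer_ge0 _)).
rewrite -forallNE => Aoo.
suff add2e (e : {posnum R}) : lebesgue_outer (\bigcup_n A n) <=
    \sum_(i <oo) lebesgue_outer (A i) + e%:num%:E.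
  by apply/lee_addgt0Pr => _/posnumP[].
rewrite (le_trans _ (epsilon_trick _ _ _))//; last first.
  by move=> k; exact: lebesgue_outer_ge0.
pose P k (B : nat -> 'rV[R]_n.+1 * 'rV[R]_n.+1) :=
  A k `<=` \bigcup_j box (B j).1 (B j).2 /\
  \sum_(j <oo) vol (B j) <=
    lebesgue_outer (A k) + (e%:num / (2 ^ k.+1)%:R)%:E.
have [G PG] : {G : nat -> nat -> 'rV[R]_n.+1 * 'rV[R]_n.+1 &
    forall k, P k (G k)}.
  apply: (@choice _ _ P) => k; rewrite /P /lebesgue_outer.
  set S := (X in ereal_inf X); move infS : (ereal_inf S) => iS.
  case: iS infS => [r Sr|Soo|Soo].
  - have en1 : (0 < e%:num / (2 ^ k.+1)%:R)%R by [].
    have /(lb_ereal_inf_adherent en1) : ereal_inf S \is a fin_num by rewrite Sr.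
    move=> [x [B AkB muBx] xS].
    by exists B; split => //; rewrite muBx -Sr; exact/ltW.
  - by have := Aoo k; rewrite /lebesgue_outer Soo.
  - by have := lebesgue_outer_ge0 (A k); rewrite /lebesgue_outer Soo.
have volG_ge0 x : 0 <= (vol \o uncurry G) x by exact: vol_ge0.
apply: (@le_trans _ _ (\esum_(i in setT) (vol \o uncurry G) i)).
  apply: ereal_inf_lbound => /=.
  have /card_esym/ppcard_eqP[f] := card_nat2.
  exists (uncurry G \o f).
    move=> t [i _] /(PG i).1 [j _ Bijt]; exists (f^-1%FUN (i, j)) => //=.
    by rewrite invK ?inE.
  rewrite -(esum_pred_image (vol \o uncurry G) _ xpredT) ?[fun=> _]set_true//.
  by rewrite image_eq.
rewrite (_ : esum _ _ = \sum_(i <oo) \sum_(j <oo) vol (G i j)); last first.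
  pose J : nat -> set (nat * nat) := fun i => [set (i, j) | j in setT].
  rewrite (_ : setT = \bigcup_k J k); last first.
    by rewrite predeqE => -[a b]; split => // _; exists a => //; exists b.
  rewrite esum_bigcupT /=; last 2 first.
    - apply/trivIsetP => i j _ _ ij.
      rewrite predeqE => -[k m] /=; split => //= -[] [_] _ [<-{k} _].
      by move=> [m' _] [] /esym/eqP; rewrite (negbTE ij).
    - by [].
  rewrite -(image_id [set: nat]) -fun_true esum_pred_image//; last first.
    by move=> k _; exact: esum_ge0.
  apply: eq_eseriesr => /= j _.
  rewrite -(esum_pred_image (vol \o uncurry G) (pair j) predT)//=; last first.
    by move=> ? ? _ _; exact: (@can_inj _ _ _ snd).
  by congr esum; rewrite predeqE => -[a b]; split; move=> [i _ <-]; exists i.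
apply: lee_nneseries => k _ *; last exact: (PG k).2.
by apply: nneseries_ge0.
Qed.

HB.instance Definition _ := isOuterMeasure.Build R 'rV[R]_n.+1 lebesgue_outer
  lebesgue_outer0 lebesgue_outer_ge0 le_lebesgue_outer
  lebesgue_outer_sigma_subadditive.

Let setc (v : 'rV[R]_n.+1) (i : 'I_n.+1) (c : R) : 'rV[R]_n.+1 :=
  (\row_j if j == i then c else v ord0 j)%R.

Let box_split a b i c :
  (box_volume a (setc b i (Num.min (b ord0 i) c)) +
   box_volume (setc a i (Num.max (a ord0 i) c)) b)%R = box_volume a b.
Proof.
rewrite /box_volume (bigD1 i)//= [X in (_ + X)%R](bigD1 i)//= [RHS](bigD1 i)//=.
rewrite !mxE eqxx.
under eq_bigr => j /negbTE ji do rewrite mxE ji.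
under [X in (_ + _ * X)%R]eq_bigr => j /negbTE ji do rewrite mxE ji.
rewrite -mulrDl; congr (_ * _)%R.
move: (a _ _) (b _ _) => x y; rewrite /Num.max /Num.min.
by repeat case: ifPn; lra.
Qed.

Lemma caratheodory_halfspace i (c : R) :
  lebesgue_outer.-caratheodory [set x : 'rV[R]_n.+1 | (x ord0 i <= c)%R].
Proof.
apply: le_caratheodory_measurable => X.
apply: le_ereal_inf_tmp => _ [ab Xab <-].
pose ab1 k := ((ab k).1, setc (ab k).2 i (Num.min ((ab k).2 ord0 i) c)).
pose ab2 k := (setc (ab k).1 i (Num.max ((ab k).1 ord0 i) c), (ab k).2).
rewrite (_ : \sum_(k <oo) _ = \sum_(k <oo) (vol (ab1 k) + vol (ab2 k))).
  rewrite nneseriesD//; apply: leeD; apply: ereal_inf_lbound.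
  - exists ab1 => // x [/Xab[k _ xk] /= xc]; exists k => //= j.
    have /andP[-> xb] := xk j; rewrite mxE /=; case: eqP => [->|//].
    by rewrite le_min xc andbT; have /andP[] := xk i.
  - exists ab2 => // x [/Xab[k _ xk] /= /negP]; rewrite -ltNge => xc.
    exists k => //= j; have /andP[ax ->] := xk j; rewrite mxE /= andbT.
    case: eqP => [->|//].
    by rewrite gt_max xc andbT; have /andP[] := xk i.
by apply: eq_eseriesr => k _; rewrite /vol -EFinD box_split.
Qed.


Lemma caratheodory_box a b : lebesgue_outer.-caratheodory (box a b).
Proof.
pose F (i : nat) := if insub i is Some j then
  [set x : 'rV[R]_n.+1 | (x ord0 j <= b ord0 j)%R] `&`
  ~` [set x : 'rV[R]_n.+1 | (x ord0 j <= a ord0 j)%R] else setT.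
have -> : box a b = ~` \bigcup_i ~` F i.
  rewrite setC_bigcup; apply/seteqP; split=> x /=.
    move=> abx i _; rewrite setCK /F; case: insubP => //= j _ _.
    by have /andP[ax ->] := abx j; split => //; apply/negP; rewrite -ltNge.
  move=> Fx i; have := Fx i I; rewrite setCK /F valK /= => -[-> /negP].
  by rewrite -ltNge => ->.
apply: caratheodory_measurable_setC; apply: caratheodory_measurable_bigcup => i.
apply: caratheodory_measurable_setC; rewrite /F; case: insubP => [j _ _|_].
  apply: caratheodory_measurable_setI; first exact: caratheodory_halfspace.
  by apply: caratheodory_measurable_setC; exact: caratheodory_halfspace.
by rewrite -setC0; apply: caratheodory_measurable_setC;
  exact: caratheodory_measurable_set0.
Qed.

Let ratv (q : 'rV[rat]_n.+1) : 'rV[R]_n.+1 := map_mx ratr q.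

Let open_bigcup_box (U : set 'rV[R]_n.+1) : open U ->
  U = \bigcup_(pq in [set pq : 'rV[rat]_n.+1 * 'rV[rat]_n.+1 |
         box (ratv pq.1) (ratv pq.2) `<=` U]) box (ratv pq.1) (ratv pq.2).
Proof.
move=> oU; apply/seteqP; split; last by move=> x [pq /=]; exact.
move=> x Ux; have [P xP PU] : nbhs x U by exact: open_nbhs_nbhs.
have /choice[pq pqP] (j : 'I_n.+1) : exists pq : rat * rat,
    (ratr pq.1 < x ord0 j < ratr pq.2)%R /\
    (forall y : R, (ratr pq.1 < y <= ratr pq.2)%R -> P ord0 j y).
  have /nbhs_ballP[e /= e0 eP] := xP ord0 j.
  have /rat_in_itvoo[p /itvP pe] : (x ord0 j - e < x ord0 j)%R.
    by rewrite ltrBlDr ltrDl.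
  have /rat_in_itvoo[q /itvP qe] : (x ord0 j < x ord0 j + e)%R.
    by rewrite ltrDl.
  exists (p, q); split => [/=|y /andP[/= py yq]]; first by rewrite pe qe.
  apply: eP; rewrite /ball /= ltr_distlC.
  by rewrite (lt_trans _ py) ?pe//= (le_lt_trans yq)// qe.
exists (\row_j (pq j).1, \row_j (pq j).2)%R => /=.
  move=> y ypq; apply: PU => i j; rewrite ord1; apply: (pqP j).2.
  by have := ypq j; rewrite !mxE.
move=> j; rewrite !mxE; have [/andP[-> xq] _] := pqP j; exact: ltW.
Qed.

Lemma caratheodory_borel (A : set 'rV[R]_n.+1) :
  measurable A -> lebesgue_outer.-caratheodory A.
Proof.
apply: smallest_sub => [|U oU].
  split => [|B mB|F mF].
  - exact: caratheodory_measurable_set0.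
  - by rewrite setTD; exact: caratheodory_measurable_setC.
  - exact: caratheodory_measurable_bigcup.
rewrite (open_bigcup_box oU).
rewrite bigcup_mkcond.
apply: (@countable_bigcupT_measurable _ (caratheodory_type lebesgue_outer)).
  exact: countableP.
move=> pq; case: ifP => _; first exact: caratheodory_box.
exact: caratheodory_measurable_set0.
Qed.

Definition lebesgue_rV (A : set 'rV[R]_n.+1) : \bar R := lebesgue_outer A.

Lemma lebesgue_rV_sigma_additive : semi_sigma_additive lebesgue_rV.
Proof.
move=> F mF tF mUF.
apply: (@caratheodory_measure_sigma_additive _ _ lebesgue_outer) => //.
- by move=> i; exact: caratheodory_borel.
- exact: caratheodory_borel.
Qed.

HB.instance Definition _ := isMeasure.Build _ _ _ lebesgue_rV
  lebesgue_outer0 lebesgue_outer_ge0 lebesgue_rV_sigma_additive.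

End lebesgue_rV.

Section geometric_means.
Context (R : realType) (n : nat).
Local Notation Rn := 'rV[R]_n.+1.
Implicit Types (A B : set Rn) (K : set (set Rn)).

Definition dilate (t : R) A : set Rn := [set t *: a | a in A].

Definition minkowski_combination (l : R) A B : set Rn :=
  [set l *: a + (1 - l) *: b | a in A & b in B].

Definition closed_under_dilations K : Prop :=
  forall A (t : R), K A -> 0 <= t -> K (dilate t A).

(* A mean is a total function of l, A and B, but only its values for l in
   [0, 1] and A, B in K are constrained. *)
Record is_geometric_mean K (gm : R -> set Rn -> set Rn -> set Rn) : Prop := {
  geometric_mean_stable : forall (l : R) A B, 0 <= l <= 1 -> K A -> K B ->
    K (gm l A B) ;
  geometric_mean_measurable : forall (l : R) A B, 0 <= l <= 1 -> K A -> K B ->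
    measurable (gm l A B) ;
  geometric_mean_sub : forall (l : R) A B, 0 <= l <= 1 -> K A -> K B ->
    gm l A B `<=` minkowski_combination l A B ;
  geometric_mean_dilate : forall (l s t : R) A B, 0 <= l <= 1 -> K A -> K B ->
    0 < s -> 0 < t ->
    gm l (dilate s A) (dilate t B) =
      dilate (s `^ l * t `^ (1 - l)) (gm l A B) }.

Definition has_density (mu : {measure set Rn -> \bar R}) (f : Rn -> R) : Prop :=
  [/\ forall x, 0 <= f x,
      measurable_fun [set: Rn] f &
      forall A, measurable A ->
        mu A = (\int[@lebesgue_rV R n]_(x in A) (f x)%:E)%E].

Definition radially_decreasing (f : Rn -> R) : Prop :=
  forall x (t : R), 0 <= t <= 1 -> f x <= f (t *: x).

(* In the next two definitions, [`^] on [\bar R] satisfies x `^ 0 = 1 (also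
   for x = 0 and x = +oo) and +oo `^ r = +oo for r != 0; moreover 0 * +oo = 0. *)
Definition log_brunn_minkowski (mu : {measure set Rn -> \bar R}) K
    (gm : R -> set Rn -> set Rn -> set Rn) : Prop :=
  forall A B (l : R), K A -> K B -> 0 <= l <= 1 ->
    (mu A `^ l * mu B `^ (1 - l) <= mu (gm l A B))%E.

Definition brunn_minkowski (mu : {measure set Rn -> \bar R}) K : Prop :=
  forall A B (l : R), K A -> K B -> 0 <= l <= 1 ->
    (l%:E * mu A `^ n.+1%:R^-1 + (1 - l)%:E * mu B `^ n.+1%:R^-1 <=
       mu (minkowski_combination l A B) `^ n.+1%:R^-1)%E.

End geometric_means.

(* Main.v *)
Require Import Defs.
From mathcomp Require Import all_boot all_order all_algebra.
From mathcomp Require Import all_classical all_reals all_analysis.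
From mathcomp Require Import measurable_realfun.
Set Implicit Arguments.
Unset Strict Implicit.
Unset Printing Implicit Defensive.
Import Order.TTheory GRing.Theory Num.Theory.
Import numFieldNormedType.Exports.
Local Open Scope classical_set_scope.
Local Open Scope ring_scope.

(** Why the theorem holds.  Let N be the dimension.

    Lebesgue measure scales by t^N under the dilation by t, and the density
    does not decrease along segments towards the origin; a change of variables
    therefore gives t^N mu(A) <= mu(tA) for 0 < t <= 1
    ([measure_dilate_ge]).

    For p in (0, 1), put s = l/p and t = (1-l)/(1-p).  Then
    lA + (1-l)B = p(sA) + (1-p)(tB)
    ([minkowski_combination_dilate]), and this set contains the p-mean of sA
    and tB, which by homogeneity is the dilate by c = s^p t^(1-p) of the
    p-mean of A and B.  The weighted AM-GM inequality gives
    c <= ps + (1-p)t = 1, so the dilation estimate applies to c, and the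
    log-Brunn-Minkowski inequality yields
    mu(lA + (1-l)B) >= c^N mu(A)^p mu(B)^(1-p).
    With a = mu(A)^(1/N) and b = mu(B)^(1/N), the N-th root of the right-hand
    side is (la/p)^p ((1-l)b/(1-p))^(1-p), a weighted geometric mean of two
    numbers whose weighted arithmetic mean is la + (1-l)b.  The choice
    p = la / (la + (1-l)b) makes these two numbers equal, and the bound becomes
    la + (1-l)b ([brunn_minkowski_of_finite_pos]).

    That choice of p requires la and (1-l)b to be positive and finite.  In the
    other cases one term of the sum is 0 or +oo, so it suffices to bound each
    term separately; since A and B contain the origin, lA + (1-l)B contains lA
    and (1-l)B, and the dilation estimate does this
    ([measure_dilate_root_ge]). *)

(** * Dilations and Lebesgue measure *)

Lemma preimage_scale (R : realType) (n : nat) (t : R) (A : set 'rV[R]_n.+1) :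
  0 < t -> ( *:%R t) @^-1` A = dilate t^-1 A.
Proof.
move=> t0; apply/seteqP; split=> x /=.
  by move=> Atx; exists (t *: x) => //; rewrite scalerK// gt_eqF.
by move=> [a Aa <-]; rewrite scalerA divff ?gt_eqF// scale1r.
Qed.

Lemma measurable_scale (R : realType) (n : nat) (t : R) :
  measurable_fun [set: 'rV[R]_n.+1] ( *:%R t : 'rV[R]_n.+1 -> 'rV[R]_n.+1).
Proof.
have mopen := @measurability _ _ 'rV[R]_n.+1 'rV[R]_n.+1 setT ( *:%R t)
  (@open 'rV[R]_n.+1) erefl.
apply: mopen => _ [U oU <-].
rewrite setTI; apply: sub_sigma_algebra.
by apply: open_comp => // x _; exact: scaler_continuous.
Qed.

Lemma measurable_dilate (R : realType) (n : nat) (t : R)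
    (A : set 'rV[R]_n.+1) :
  0 < t -> measurable A -> measurable (dilate t A).
Proof.
move=> t0 mA; rewrite -(invrK t) -preimage_scale ?invr_gt0//.
rewrite -[X in measurable X]setTI.
exact: measurable_scale.
Qed.

Lemma box_volumeZ (R : realType) (n : nat) (t : R) (a b : 'rV[R]_n.+1) :
  0 <= t -> box_volume (t *: a) (t *: b) = t ^+ n.+1 * box_volume a b.
Proof.
move=> t0; rewrite /box_volume -[in t ^+ _](card_ord n.+1) -prodr_const.
rewrite -big_split /=; apply: eq_bigr => i _.
by rewrite !mxE maxr_pMr// mulr0 mulrBr.
Qed.

(** Dilating every box of a cover of X gives a cover of the dilate of X. *)
Lemma lebesgue_outer_dilate_le (R : realType) (n : nat) (t : R)
    (X : set 'rV[R]_n.+1) : 0 < t ->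
  (lebesgue_outer (dilate t X) <= (t ^+ n.+1)%:E * lebesgue_outer X)%E.
Proof.
move=> t0; rewrite /lebesgue_outer -ereal_inf_pZl ?exprn_gt0//.
apply/ereal_inf_le_tmp => _ [_ [ab Xab <-] <-].
exists (fun k => (t *: (ab k).1, t *: (ab k).2)).
  move=> _ [x /Xab[k _ xk] <-]; exists k => //= i.
  by rewrite !mxE ltr_pM2l// ler_pM2l//; exact: xk.
rewrite -nneseriesZl//; last by move=> k _; rewrite lee_fin box_volume_ge0.
by apply: eq_eseriesr => k _; rewrite box_volumeZ ?ltW// EFinM.
Qed.

(** The reverse inequality is [lebesgue_outer_dilate_le] for the inverse
    dilation. *)
Lemma lebesgue_rV_dilate (R : realType) (n : nat) (t : R)
    (X : set 'rV[R]_n.+1) : 0 < t ->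
  lebesgue_rV (dilate t X) = ((t ^+ n.+1)%:E * lebesgue_rV X)%E.
Proof.
move=> t0; apply/eqP; rewrite eq_le lebesgue_outer_dilate_le//=.
rewrite muleC -lee_pdivlMr ?exprn_gt0// muleC -exprVn /lebesgue_rV.
have {1}-> : X = dilate t^-1 (dilate t X).
  rewrite -preimage_scale//; apply/seteqP; split=> x /=; first by exists x.
  by move=> [y Xy /(scalerI (lt0r_neq0 t0)) <-].
by apply: lebesgue_outer_dilate_le; rewrite invr_gt0.
Qed.

(** The image of Lebesgue measure under the dilation by t is t^-N times
    Lebesgue measure, so this is the transfer formula for image measures. *)
Lemma integral_dilate (R : realType) (n : nat) (t : R) (A : set 'rV[R]_n.+1)
    (f : 'rV[R]_n.+1 -> \bar R) :
  0 < t -> measurable A -> measurable_fun [set: 'rV[R]_n.+1] f ->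
  (forall x, 0 <= f x)%E ->
  (\int[@lebesgue_rV R n]_(x in dilate t A) f x =
   (t ^+ n.+1)%:E * \int[@lebesgue_rV R n]_(x in A) f (t *: x)%R)%E.
Proof.
move=> t0 mA mf f0.
have mtA := measurable_dilate t0 mA.
have tV0 : 0 <= t^-1 ^+ n.+1 by rewrite exprn_ge0// invr_ge0 ltW.
have preA : *:%R t @^-1` dilate t A = A.
  apply/seteqP; split=> [x [a Aa /(scalerI (lt0r_neq0 t0)) <-//]|x Ax].
  by exists x.
rewrite -{2}preA.
rewrite -(@ge0_integral_pushforward _ _ _ _ _ _
  (@measurable_scale R n t) _ _ f)//;
  last exact: measurable_funS mf.
have -> : (
    \int[pushforward (@lebesgue_rV R n) ( *:%R t)]_(x in dilate t A) f x =
    \int[mscale (NngNum tV0) (@lebesgue_rV R n)]_(x in dilate t A) f x)%E.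
  apply: eq_measure_integral => [|mt S mS _]; first exact: measurable_scale.
  transitivity (lebesgue_rV ( *:%R t @^-1` S)); first by [].
  by rewrite preimage_scale// lebesgue_rV_dilate ?invr_gt0.
rewrite (ge0_integral_mscale (@lebesgue_rV R n) mtA (NngNum tV0))//;
  last exact: measurable_funS mf.
by rewrite muleA -EFinM /= -exprMn divff ?gt_eqF// expr1n mul1e.
Qed.

(** * Measures with a radially decreasing density *)

(** After the change of variables, the integrand at x is f (t x), which is at
    least f x. *)
Lemma measure_dilate_ge (R : realType) (n : nat)
    (mu : {measure set 'rV[R]_n.+1 -> \bar R}) (f : 'rV[R]_n.+1 -> R)
    (t : R) (A : set 'rV[R]_n.+1) :
  has_density mu f -> radially_decreasing f -> measurable A -> 0 < t <= 1 ->
  ((t ^+ n.+1)%:E * mu A <= mu (dilate t A))%E.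
Proof.
move=> [f0 mf muE] df mA /andP[t0 t1].
have mEf : measurable_fun [set: 'rV[R]_n.+1] (fun x => (f x)%:E).
  exact/measurable_EFinP.
rewrite !muE//; last exact: measurable_dilate.
rewrite (integral_dilate (f := fun x => (f x)%:E))//.
apply: lee_wpmul2l; first by rewrite lee_fin exprn_ge0// ltW.
apply: ge0_le_integral => //.
- by move=> x _; rewrite lee_fin.
- exact: measurable_funS mEf.
- apply: (@measurable_funS _ _ _ _ setT) => //.
  exact: (measurableT_comp mEf (@measurable_scale R n t)).
- by move=> x _; rewrite lee_fin df// ltW.
Qed.

Lemma le_poweR (R : realType) (r : R) (x y : \bar R) :
  0 <= r -> (0 <= x -> x <= y -> x `^ r <= y `^ r)%E.
Proof.
move=> r0 x0 xy; apply: gt0_ler_poweR => //; rewrite in_itv /= leey andbT//.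
exact: le_trans xy.
Qed.

Lemma powRX_invn (R : realType) (n : nat) (x : R) :
  0 <= x -> (x ^+ n.+1) `^ n.+1%:R^-1 = x.
Proof.
by move=> x0; rewrite -powR_mulrn// -powRrM divff ?pnatr_eq0// powRr1.
Qed.

Lemma powR_invnX (R : realType) (n : nat) (x : R) :
  0 <= x -> (x `^ n.+1%:R^-1) ^+ n.+1 = x.
Proof.
by move=> x0; rewrite -powR_mulrn ?powR_ge0// -powRrM mulVf ?pnatr_eq0// powRr1.
Qed.

Lemma le_root_of_powerX (R : realType) (n : nat) (x : R) (y : \bar R) :
  0 <= x -> ((x ^+ n.+1)%:E <= y -> x%:E <= y `^ n.+1%:R^-1)%E.
Proof.
move=> x0 xy; rewrite -[x in leLHS](powRX_invn n x0) -poweR_EFin.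
by apply: le_poweR; rewrite ?invr_ge0 ?ler0n// lee_fin exprn_ge0.
Qed.

(** The N-th root form of [measure_dilate_ge]. The factor t = 0 is included
    because the left-hand side then vanishes, whatever the measure of A. *)
Lemma measure_dilate_root_ge (R : realType) (n : nat)
    (mu : {measure set 'rV[R]_n.+1 -> \bar R}) (f : 'rV[R]_n.+1 -> R)
    (t : R) (A : set 'rV[R]_n.+1) :
  has_density mu f -> radially_decreasing f -> measurable A -> 0 <= t <= 1 ->
  (t%:E * mu A `^ n.+1%:R^-1 <= mu (dilate t A) `^ n.+1%:R^-1)%E.
Proof.
move=> muf df mA /andP[]; rewrite le_eqVlt => /predU1P[<- _|t0 t1].
  by rewrite mul0e poweR_ge0.
have tn0 : 0 <= t ^+ n.+1 by rewrite exprn_ge0// ltW.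
rewrite -[t in leLHS](powRX_invn n (ltW t0)) -poweR_EFin -poweRM//.
apply: le_poweR; rewrite ?invr_ge0 ?ler0n// ?mule_ge0//.
by apply: measure_dilate_ge muf df mA _; rewrite t0.
Qed.

(** * Convex combinations of numbers and of sets *)

(** Young's inequality for the conjugate exponents 1/p and 1/(1-p), applied to
    s^p and t^(1-p). *)
Lemma weighted_AMGM (R : realType) (p s t : R) : 0 < p < 1 -> 0 < s -> 0 < t ->
  s `^ p * t `^ (1 - p) <= p * s + (1 - p) * t.
Proof.
move=> /andP[p0 p1] s0 t0; have q0 : 0 < 1 - p by rewrite subr_gt0.
have := @conjugate_powR R (s `^ p) (t `^ (1 - p)) p^-1 (1 - p)^-1
  (powR_ge0 _ _) (powR_ge0 _ _).
rewrite !invr_gt0 !invrK -!powRrM !divff ?gt_eqF// (powRr1 (ltW s0)).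
rewrite (powRr1 (ltW t0)) [s * p]mulrC [t * _]mulrC; apply => //.
by rewrite subrKC.
Qed.

Lemma dilate_subset_minkowski_l (R : realType) (n : nat) (l : R)
    (A B : set 'rV[R]_n.+1) :
  B 0 -> dilate l A `<=` minkowski_combination l A B.
Proof.
by move=> B0 _ [a Aa <-]; exists a => //; exists 0; rewrite // scaler0 addr0.
Qed.

Lemma dilate_subset_minkowski_r (R : realType) (n : nat) (l : R)
    (A B : set 'rV[R]_n.+1) :
  A 0 -> dilate (1 - l) B `<=` minkowski_combination l A B.
Proof.
by move=> A0 _ [b Bb <-]; exists 0 => //; exists b; rewrite // scaler0 add0r.
Qed.

(** One Minkowski combination can be written with any other weight p at the
    price of dilating the sets; the freedom in p is what turns a multiplicative
    inequality into an additive one. *)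
Lemma minkowski_combination_dilate (R : realType) (n : nat) (l p s t : R)
    (A B : set 'rV[R]_n.+1) : p * s = l -> (1 - p) * t = 1 - l ->
  minkowski_combination p (dilate s A) (dilate t B) =
  minkowski_combination l A B.
Proof.
move=> psl ptl; apply/seteqP; split=> x.
  move=> [_ [a Aa <-] [_ [b Bb <-] <-]]; exists a => //; exists b => //.
  by rewrite !scalerA psl ptl.
move=> [a Aa [b Bb <-]]; exists (s *: a); first by exists a.
by exists (t *: b); [exists b|rewrite !scalerA psl ptl].
Qed.

(** The homogeneity factor of the geometric mean is a contraction, as
    [measure_dilate_ge] requires. *)
Lemma dilation_factor_le1 (R : realType) (l p s t : R) :
  0 < p < 1 -> 0 < s -> 0 < t -> p * s = l -> (1 - p) * t = 1 - l ->
  0 < s `^ p * t `^ (1 - p) <= 1.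
Proof.
move=> p01 s0 t0 psl ptl; rewrite mulr_gt0 ?powR_gt0//=.
by rewrite (le_trans (weighted_AMGM p01 s0 t0))// psl ptl subrKC.
Qed.

(** * From the multiplicative to the additive inequality *)

(** The weight of the mean is tuned to A and B: it is the share of the term
    l * a in the sum l * a + (1 - l) * b. *)
Lemma brunn_minkowski_of_finite_pos (R : realType) (n : nat)
  (K : set (set 'rV[R]_n.+1))
  (gm : R -> set 'rV[R]_n.+1 -> set 'rV[R]_n.+1 -> set 'rV[R]_n.+1)
  (mu : {measure set 'rV[R]_n.+1 -> \bar R}) (f : 'rV[R]_n.+1 -> R)
  (K_dilations : closed_under_dilations K)
  (K_sums : forall (A B : set 'rV[R]_n.+1) (l : R), K A -> K B ->
     0 <= l <= 1 -> measurable (minkowski_combination l A B))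
  (gm_mean : is_geometric_mean K gm)
  (mu_density : has_density mu f)
  (f_decreasing : radially_decreasing f)
  (mu_log_brunn_minkowski : log_brunn_minkowski mu K gm)
  (A B : set 'rV[R]_n.+1) (l a b : R) :
  K A -> K B -> 0 < l < 1 -> 0 < a -> 0 < b ->
  mu A = (a ^+ n.+1)%:E -> mu B = (b ^+ n.+1)%:E ->
  (((l * a + (1 - l) * b) ^+ n.+1)%:E <= mu (minkowski_combination l A B))%E.
Proof.
move=> KA KB /andP[l0 l1] a0 b0 muA muB.
have l'0 : 0 < 1 - l by rewrite subr_gt0.
set S := l * a + (1 - l) * b.
have la0 : 0 < l * a by rewrite mulr_gt0.
have lb0 : 0 < (1 - l) * b by rewrite mulr_gt0.
have S0 : 0 < S by rewrite addr_gt0.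
(* The weight p equalizes s a = l a / p and t b = (1 - l) b / (1 - p): both are
   then equal to S. *)
pose p := l * a / S; pose s := S / a; pose t := S / b.
have qE : 1 - p = (1 - l) * b / S.
  by rewrite /p -{1}(divff (lt0r_neq0 S0)) -mulrBl /S addrC addKr.
have p01 : 0 < p < 1 by rewrite -(subr_gt0 p) qE !divr_gt0.
have [s0 t0] : 0 < s /\ 0 < t by rewrite !divr_gt0.
have psl : p * s = l by rewrite /p /s mulrA divfK ?mulfK// gt_eqF.
have ptl : (1 - p) * t = 1 - l by rewrite qE /t mulrA divfK ?mulfK// gt_eqF.
have p01' : 0 <= p <= 1 by case/andP: p01 => *; rewrite !ltW.
have [c0 c1] := andP (dilation_factor_le1 p01 s0 t0 psl ptl).
set c := s `^ p * t `^ (1 - p) in c0 c1.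
have cab : c * (a `^ p * b `^ (1 - p)) = S.
  rewrite /c mulrACA -!powRM ?ltW// /s /t !divfK ?gt_eqF//.
  by rewrite -powRD ?subrKC ?powRr1 ?ltW// oner_eq0.
have mgm : measurable (gm p A B).
  by apply: (geometric_mean_measurable gm_mean).
have mcgm : measurable (dilate c (gm p A B)) by exact: measurable_dilate.
have mAB : measurable (minkowski_combination l A B).
  by apply: K_sums => //; rewrite !ltW.
have sub : dilate c (gm p A B) `<=` minkowski_combination l A B.
  rewrite -(geometric_mean_dilate gm_mean)//.
  rewrite -(minkowski_combination_dilate _ _ psl ptl).
  by apply: (geometric_mean_sub gm_mean) => //;
    apply: K_dilations => //; exact: ltW.
apply: le_trans (le_measure mu _ _ sub); rewrite ?inE//.
apply: le_trans (measure_dilate_ge mu_density f_decreasing mgm _);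
  last by rewrite c0.
rewrite -cab exprMn EFinM; apply: lee_wpmul2l.
  by rewrite lee_fin exprn_ge0// ltW.
apply: le_trans (mu_log_brunn_minkowski _ _ _ KA KB p01').
rewrite muA muB !poweR_EFin -EFinM lee_fin exprMn.
have powRX x r : 0 < x -> (x `^ r) ^+ n.+1 = (x ^+ n.+1) `^ r.
  by move=> x0; rewrite -!powR_mulrn ?powR_ge0 ?(ltW x0)// powRAC.
by rewrite !powRX.
Qed.

Theorem proposition1 (R : realType) (n : nat)
  (K : set (set 'rV[R]_n.+1))
  (gm : R -> set 'rV[R]_n.+1 -> set 'rV[R]_n.+1 -> set 'rV[R]_n.+1)
  (mu : {measure set 'rV[R]_n.+1 -> \bar R}) (f : 'rV[R]_n.+1 -> R)
  (K_measurable : forall A : set 'rV[R]_n.+1, K A -> measurable A)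
  (K_origin : forall A : set 'rV[R]_n.+1, K A -> A 0)
  (K_dilations : closed_under_dilations K)
  (K_sums : forall (A B : set 'rV[R]_n.+1) (l : R), K A -> K B ->
     0 <= l <= 1 -> measurable (minkowski_combination l A B))
  (gm_mean : is_geometric_mean K gm)
  (mu_density : has_density mu f)
  (f_decreasing : radially_decreasing f)
  (mu_log_brunn_minkowski : log_brunn_minkowski mu K gm) :
  brunn_minkowski mu K.
Proof.
move=> A B l KA KB l01; have [l0 l1] := andP l01.
have l'01 : 0 <= 1 - l <= 1 by rewrite subr_ge0 l1 gerBl.
have mAB := K_sums _ _ _ KA KB l01.
have r0 : 0 <= n.+1%:R^-1 :> R by rewrite invr_ge0 ler0n.
have leA : (l%:E * mu A `^ n.+1%:R^-1 <=
    mu (minkowski_combination l A B) `^ n.+1%:R^-1)%E.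
  apply: le_trans (measure_dilate_root_ge mu_density f_decreasing
    (K_measurable _ KA) l01) _.
  apply: le_poweR => //; apply: le_measure; rewrite ?inE//.
    by apply: K_measurable; exact: K_dilations.
  exact: dilate_subset_minkowski_l (K_origin _ KB).
have leB : ((1 - l)%:E * mu B `^ n.+1%:R^-1 <=
    mu (minkowski_combination l A B) `^ n.+1%:R^-1)%E.
  apply: le_trans (measure_dilate_root_ge mu_density f_decreasing
    (K_measurable _ KB) l'01) _.
  apply: le_poweR => //; apply: le_measure; rewrite ?inE//.
    by apply: K_measurable; apply: K_dilations => //; case/andP: l'01.
  exact: dilate_subset_minkowski_r (K_origin _ KA).
have [A0|A0] := eqVneq (l%:E * mu A `^ n.+1%:R^-1)%E 0%E.
  by rewrite A0 add0e.
have [B0|B0] := eqVneq ((1 - l)%:E * mu B `^ n.+1%:R^-1)%E 0%E.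
  by rewrite B0 adde0.
move: A0; rewrite mule_eq0 negb_or eqe poweR_eq0// negb_and => /andP[lN0 A0].
move: B0; rewrite mule_eq0 negb_or eqe poweR_eq0// negb_and => /andP[l'N0 B0].
have rN0 : n.+1%:R^-1 != 0 :> R by rewrite invr_eq0 pnatr_eq0.
have {}l0 : 0 < l by rewrite lt_neqAle eq_sym lN0.
have {}l1 : 0 < 1 - l by rewrite lt_neqAle eq_sym l'N0 subr_ge0.
rewrite rN0 /= orbF in A0; rewrite rN0 /= orbF in B0.
have [Ay|Ay] := eqVneq (mu A) +oo%E.
  move: leA; rewrite Ay poweRyr// gt0_muley ?lte_fin// leye_eq => /eqP ->.
  by rewrite leey.
have [By|By] := eqVneq (mu B) +oo%E.
  move: leB; rewrite By poweRyr// gt0_muley ?lte_fin// leye_eq => /eqP ->.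
  by rewrite leey.
have root X : (mu X != 0 -> mu X != +oo -> exists2 x, (0 < x)%R &
    mu X = (x ^+ n.+1)%:E /\ mu X `^ n.+1%:R^-1 = x%:E)%E.
  move=> X0 Xy; have Xfin : mu X \is a fin_num.
    by rewrite ge0_fin_numE// lt_neqAle Xy leey.
  move: X0; rewrite -(fineK Xfin) eqe => X0.
  have {}X0 : 0 < fine (mu X) by rewrite lt_neqAle eq_sym X0 fine_ge0.
  exists (fine (mu X) `^ n.+1%:R^-1); first exact: powR_gt0.
  by rewrite powR_invnX ?ltW.
have [a a0 [muA ->]] := root _ A0 Ay.
have [b b0 [muB ->]] := root _ B0 By.
rewrite -!EFinM -EFinD; apply: le_root_of_powerX.
  by rewrite ltW// addr_gt0// mulr_gt0.
apply: (brunn_minkowski_of_finite_pos K_dilations K_sums gm_mean mu_density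
  f_decreasing) => //.
by rewrite l0 -subr_gt0.
Qed.
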